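(* Let $\widehat C$ be a smooth space curve parametrized by $w(x)=(x,y(x),z(x))$, $x$ in an open interval, with $z\neq0$, $z-x\,z_x\neq0$, $\Delta\neq0$, $\kappa>0$ and $\widehat\alpha\neq0$ at every point, and let $C=\Pi_0(\widehat C)$ be its image under the central projection $\Pi_0(x,y,z)=(x/z,\,y/z)$. Then at each point of $\widehat C$ the value $\widehat\eta$ of the projective curvature of the plane curve $C$ at the corresponding image point is given in terms of the centro-affine differential invariants of $\widehat C$ by $$\widehat\eta=3^{-2/3}\left(\widehat\alpha^{-5/3}\,\widehat\alpha_{\sigma\sigma}-\tfrac76\,\widehat\alpha^{-8/3}\,\widehat\alpha_\sigma^2+\tfrac32\,\widehat\alpha^{-2/3}\bigl(\widehat\kappa_\sigma+\tfrac14\widehat\kappa^2-1\bigr)\right),$$ and, where $\widehat\alpha>0$, this equals $$3^{1/3}\left(-2\,\widehat\alpha^{-1/2}D_\sigma^2\bigl(\widehat\alpha^{-1/6}\bigr)+\tfrac12\,\widehat\alpha^{-2/3}\bigl(\widehat\kappa_\sigma+\tfrac14\widehat\kappa^2-1\bigr)\right).$$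
   Context: Fractional powers with denominator 3 are real cube-root powers. $[a,b,c]=a\cdot(b\times c)$ denotes the determinant of the $3\times 3$ matrix with rows $a,b,c\in\mathbb{R}^3$. Space curve invariants. For a curve $w(t)$ in $\mathbb{R}^3$ set $\Delta=[w,w_t,w_{tt}]$; the centro-equi-affine arc length is $ds=\Delta^{1/3}dt$ (with $D_s=\Delta^{-1/3}D_t$), so $[w,w_s,w_{ss}]=1$. The centro-equi-affine curvature and torsion are $\kappa=[w,w_{ss},w_{sss}]$ and $\tau=[w_s,w_{ss},w_{sss}]$. Where $\kappa>0$, the centro-affine arc length element is $d\sigma=\sqrt{\kappa}\,ds$, with $D_\sigma=\kappa^{-1/2}D_s$, and the fundamental centro-affine differential invariants are $\widehat\kappa=\kappa_s/\kappa^{3/2}$ and $\widehat\tau=\tau/\kappa^{3/2}$. Set $\widehat\alpha=\widehat\kappa+2\widehat\tau=(\kappa_s+2\tau)/\kappa^{3/2}$. Subscripts $s$, $\sigma$ denote derivatives with respect to $s$, $\sigma$. Plane projective curvature. For a plane curve $Y=Y(X)$ with $Y_i=d^iY/dX^i$, $Y_2\neq0$, put $\mu=\dfrac{3Y_2Y_4-5Y_3^2}{3\,Y_2^{8/3}}$ and $d\chi=Y_2^{1/3}dX$, with subscripts $\chi$ denoting derivatives under $D_\chi=Y_2^{-1/3}D_X$. Where moreover $\mu_\chi\neq0$, the projective curvature is $$\eta=\frac{6\,\mu_{\chi\chi\chi}\,\mu_\chi-7\,\mu_{\chi\chi}^2-3\,\mu\,\mu_\chi^2}{6\,\mu_\chi^{8/3}}.$$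 For the projected curve, $X=x/z(x)$, $Y=y(x)/z(x)$, which is locally a graph $Y=Y(X)$ because $z-x\,z_x\ne0$. *)

(* Defs.v *)
(* Stdlib real numbers with Coquelicot's total derivative [Derive]. *)
From Stdlib Require Import Reals ZArith Lra.
From Coquelicot Require Import Coquelicot.
Open Scope R_scope.

Definition cbrt (x : R) : R := sign x * Rpower (Rabs x) (1 / 3).

(* [cbrt_pow x p] is x^(p/3) through the real cube root, for x of either sign
   (x <> 0 when p < 0). *)
Definition cbrt_pow (x : R) (p : Z) : R := powerRZ (cbrt x) p.

Lemma cbrt_cube (x : R) : cbrt x ^ 3 = x.
Proof.
assert (pos : forall y, 0 < y -> cbrt y ^ 3 = y).
{ intros y Hy. unfold cbrt.
  rewrite (sign_eq_1 y Hy), Rabs_pos_eq, Rmult_1_l by lra.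
  rewrite <- Rpower_pow by apply exp_pos.
  rewrite Rpower_mult.
  replace (1 / 3 * INR 3) with 1 by (simpl; field).
  now apply Rpower_1. }
destruct (Rtotal_order x 0) as [Hx | [-> | Hx]].
- assert (E : cbrt (- x) = - cbrt x).
  { unfold cbrt. rewrite sign_opp, Rabs_Ropp. ring. }
  assert (H := pos (- x) ltac:(lra)). rewrite E in H.
  replace ((- cbrt x) ^ 3) with (- cbrt x ^ 3) in H by ring. lra.
- unfold cbrt. rewrite sign_0. ring.
- now apply pos.
Qed.

Definition smooth_at (f : R -> R) (x : R) : Prop :=
  locally x (fun u => forall n : nat, ex_derive_n f n u).

Record vec3 : Type := Vec3 { vx : R; vy : R; vz : R }.

Definition scale3 (c : R) (a : vec3) : vec3 :=
  Vec3 (c * vx a) (c * vy a) (c * vz a).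

Definition dot3 (a b : vec3) : R := vx a * vx b + vy a * vy b + vz a * vz b.

Definition cross3 (a b : vec3) : vec3 :=
  Vec3 (vy a * vz b - vz a * vy b)
       (vz a * vx b - vx a * vz b)
       (vx a * vy b - vy a * vx b).

Definition det3 (a b c : vec3) : R := dot3 a (cross3 b c).

(** Space curves [w : R -> vec3]. All quantities, including the arc lengths
    s and sigma, are handled as functions of the given parameter t; s and sigma
    enter only through the operators D_s and D_sigma. *)

Definition Dvec (w : R -> vec3) (t : R) : vec3 :=
  Vec3 (Derive (fun u => vx (w u)) t)
       (Derive (fun u => vy (w u)) t)
       (Derive (fun u => vz (w u)) t).

Definition w_Delta (w : R -> vec3) (t : R) : R :=
  det3 (w t) (Dvec w t) (Dvec (Dvec w) t).

(* In the next operators [w] fixes the arc length and [f] or [v] is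
   differentiated. *)
Definition Ds (w : R -> vec3) (f : R -> R) (t : R) : R :=
  cbrt_pow (w_Delta w t) (-1) * Derive f t.

Definition Ds_vec (w : R -> vec3) (v : R -> vec3) (t : R) : vec3 :=
  scale3 (cbrt_pow (w_Delta w t) (-1)) (Dvec v t).

Definition w_s (w : R -> vec3) : R -> vec3 := Ds_vec w w.
Definition w_ss (w : R -> vec3) : R -> vec3 := Ds_vec w (w_s w).
Definition w_sss (w : R -> vec3) : R -> vec3 := Ds_vec w (w_ss w).

Definition kappa (w : R -> vec3) (t : R) : R :=
  det3 (w t) (w_ss w t) (w_sss w t).

Definition tau (w : R -> vec3) (t : R) : R :=
  det3 (w_s w t) (w_ss w t) (w_sss w t).

Definition Dsigma (w : R -> vec3) (f : R -> R) (t : R) : R :=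
  Rpower (kappa w t) (-1 / 2) * Ds w f t.

Definition kappa_hat (w : R -> vec3) (t : R) : R :=
  Ds w (kappa w) t / Rpower (kappa w t) (3 / 2).

Definition tau_hat (w : R -> vec3) (t : R) : R :=
  tau w t / Rpower (kappa w t) (3 / 2).

Definition alpha_hat (w : R -> vec3) (t : R) : R :=
  kappa_hat w t + 2 * tau_hat w t.

(** Graphs Y = Y(X) in the plane. *)

Definition mu (Y : R -> R) (X : R) : R :=
  (3 * Derive_n Y 2 X * Derive_n Y 4 X - 5 * (Derive_n Y 3 X) ^ 2)
  / (3 * cbrt_pow (Derive_n Y 2 X) 8).

Definition Dchi (Y : R -> R) (f : R -> R) (X : R) : R :=
  cbrt_pow (Derive_n Y 2 X) (-1) * Derive f X.

Definition mu_chi (Y : R -> R) : R -> R := Dchi Y (mu Y).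
Definition mu_chichi (Y : R -> R) : R -> R := Dchi Y (mu_chi Y).
Definition mu_chichichi (Y : R -> R) : R -> R := Dchi Y (mu_chichi Y).

Definition eta (Y : R -> R) (X : R) : R :=
  (6 * mu_chichichi Y X * mu_chi Y X - 7 * (mu_chichi Y X) ^ 2
     - 3 * mu Y X * (mu_chi Y X) ^ 2)
  / (6 * cbrt_pow (mu_chi Y X) 8).

(* The conditions under which [eta Y X] is the projective curvature, rather
   than a junk value of the total operators. *)
Definition eta_defined (Y : R -> R) (X : R) : Prop :=
  smooth_at Y X /\ Derive_n Y 2 X <> 0 /\ mu_chi Y X <> 0.

Definition Pi0 (p : vec3) : R * R := (vx p / vz p, vy p / vz p).

(* The branch through parameter [t0] of the projection of [w] is the graph
   of [Y]. When the first coordinate of the projection is a local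
   diffeomorphism at [t0], this determines [Y] near the image point. *)
Definition is_projected_graph (w : R -> vec3) (t0 : R) (Y : R -> R) : Prop :=
  locally t0 (fun t => Y (fst (Pi0 (w t))) = snd (Pi0 (w t))).

(* Main.v *)
(** Writing the curve as [w = z u], where [u = (X, Y, 1)] lifts the projected curve, one
    has [ds = z d chi], that is, [D_chi = z D_s]. The Frenet equation
    [w_sss = tau w - kappa w_s] gives [X_chichichi = - (mu / 3) X_chi] with
    [mu = 3 (kappa z^2 + 2 z z_ss - z_s^2)], hence [mu_chi = 3 z^3 A] with
    [A = kappa_s + 2 tau = kappa^(3/2) alpha_hat]. In the numerator of [eta] all
    derivatives of [z] cancel, and [eta] becomes an expression in [A], [A_s], [A_ss] and
    [kappa], which is rewritten with [D_s = kappa^(1/2) D_sigma].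

    Everything is computed with functions of the curve parameter [t]; derivatives of [Y]
    are obtained by the chain rule, and a smooth local inverse of [X] makes [Y] smooth. *)
Require Import Defs.
From Stdlib Require Import Reals ZArith Lra Lia Ranalysis5.
From Coquelicot Require Import Coquelicot.
Open Scope R_scope.

(** * Smooth functions on open sets *)

(** The recursion peels off the first derivative, so closure properties follow by induction on [k].
    The finite order [k] lets a differential equation raise the regularity one step at a time. *)
Fixpoint diff_on (k : nat) (U : R -> Prop) (f : R -> R) : Prop :=
  match k with
  | O => True
  | S k => (forall t, U t -> ex_derive f t) /\ diff_on k U (Derive f)
  end.

Definition smooth_on (U : R -> Prop) (f : R -> R) : Prop :=
  forall k, diff_on k U f.

Lemma diff_on_iff_Derive_n (U : R -> Prop) (k : nat) (f : R -> R) :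
  diff_on k U f <->
  forall n t, (n < k)%nat -> U t -> ex_derive (Derive_n f n) t.
Proof.
(* [Derive_n] adds derivatives on the outside, [diff_on] on the inside; the two iterations have to
   be matched. *)
assert (E : forall (g : R -> R) n t, Derive_n (Derive g) n t = Derive_n g (S n) t).
{ intros g n t. change (Derive g) with (Derive_n g 1).
  rewrite Derive_n_comp. now replace (n + 1)%nat with (S n) by lia. }
revert f; induction k as [|k IH]; intros f; simpl.
- split; [intros _ n t Hn; lia | easy].
- rewrite IH; split.
  + intros [H0 H] [|n] t Hn Ht; [now apply H0|].
    apply (ex_derive_ext (Derive_n (Derive f) n)); [intros u; apply E|].
    apply H; [lia | easy].
  + intros H; split.
    * intros t Ht. apply (H O); [lia | easy].
    * intros n t Hn Ht.
      apply (ex_derive_ext (Derive_n f (S n))); [intros u; symmetry; apply E|].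
      apply H; [lia | easy].
Qed.

(** Carries the pointwise smoothness hypotheses into the calculus on open sets, and carries
    smoothness of [Y] back to [eta_defined]. *)
Lemma smooth_on_iff_smooth_at (U : R -> Prop) (f : R -> R) :
  open U -> (smooth_on U f <-> forall t, U t -> smooth_at f t).
Proof.
intros HU; split.
- intros H t Ht. unfold smooth_at. apply (filter_imp U); [|now apply HU].
  intros u Hu [|n]; [easy|].
  apply (proj1 (diff_on_iff_Derive_n U (S n) f) (H (S n))); [lia | easy].
- intros H k. apply diff_on_iff_Derive_n. intros n t _ Ht.
  exact (locally_singleton _ _ (H t Ht) (S n)).
Qed.

Lemma diff_on_subset (U V : R -> Prop) (k : nat) (f : R -> R) :
  (forall t, V t -> U t) -> diff_on k U f -> diff_on k V f.
Proof.
intros HVU; revert f; induction k as [|k IH]; intros f; simpl; [easy|].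
intros [H0 H]; split; auto.
Qed.

Lemma diff_on_pred (U : R -> Prop) (k : nat) (f : R -> R) :
  diff_on (S k) U f -> diff_on k U f.
Proof.
revert f; induction k as [|k IH]; intros f; [easy|].
intros [H0 H]; split; [easy | now apply IH].
Qed.

(** Openness makes the equality hold near each point of [U], so the derivatives agree on [U] as well
    and the induction continues. *)
Lemma diff_on_ext (U : R -> Prop) (k : nat) (f g : R -> R) :
  open U -> (forall t, U t -> f t = g t) -> diff_on k U f -> diff_on k U g.
Proof.
intros HU; revert f g; induction k as [|k IH]; intros f g E; [easy|].
assert (L : forall t, U t -> locally t (fun u => f u = g u)).
{ intros t Ht. apply (filter_imp U); [exact E | now apply HU]. }
intros [H0 H]; split.
- intros t Ht. apply (ex_derive_ext_loc f); auto.
- apply (IH (Derive f)); [|easy].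
  intros t Ht. apply Derive_ext_loc; auto.
Qed.

Lemma diff_on_const (U : R -> Prop) (k : nat) (c : R) :
  diff_on k U (fun _ => c).
Proof.
apply diff_on_iff_Derive_n. intros n t _ _.
exact (ex_derive_n_const c (S n) t).
Qed.

Lemma diff_on_id (U : R -> Prop) (k : nat) : open U -> diff_on k U (fun t => t).
Proof.
intros HU. destruct k as [|k]; [easy|]. split.
- intros t _. apply ex_derive_id.
- apply (diff_on_ext _ _ (fun _ => 1) _ HU).
  + intros t _. symmetry. apply Derive_id.
  + apply diff_on_const.
Qed.

Lemma diff_on_plus (U : R -> Prop) (k : nat) (f g : R -> R) :
  open U -> diff_on k U f -> diff_on k U g -> diff_on k U (fun t => f t + g t).
Proof.
intros HU; revert f g; induction k as [|k IH]; intros f g; [easy|].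
intros [Hf0 Hf] [Hg0 Hg]; split.
- intros t Ht. apply (ex_derive_plus f g t); auto.
- apply (diff_on_ext _ _ (fun t => Derive f t + Derive g t) _ HU); [|now apply IH].
  intros t Ht. symmetry. apply Derive_plus; auto.
Qed.

Lemma diff_on_mult (U : R -> Prop) (k : nat) (f g : R -> R) :
  open U -> diff_on k U f -> diff_on k U g -> diff_on k U (fun t => f t * g t).
Proof.
intros HU; revert f g; induction k as [|k IH]; intros f g; [easy|].
(* The product rule keeps an undifferentiated factor in each term, so both factors are also needed
   at the lower order. *)
intros Hf Hg. pose proof (diff_on_pred _ _ _ Hf) as Hf'.
pose proof (diff_on_pred _ _ _ Hg) as Hg'.
destruct Hf as [Hf0 Hf], Hg as [Hg0 Hg]; split.
- intros t Ht. apply ex_derive_mult; auto.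
- apply (diff_on_ext _ _ (fun t => Derive f t * g t + f t * Derive g t) _ HU).
  + intros t Ht. symmetry. apply Derive_mult; auto.
  + apply diff_on_plus; auto.
Qed.

Lemma diff_on_comp (U V : R -> Prop) (k : nat) (f g : R -> R) :
  open U -> (forall t, U t -> V (f t)) ->
  diff_on k V g -> diff_on k U f -> diff_on k U (fun t => g (f t)).
Proof.
intros HU HUV; revert f g HUV; induction k as [|k IH]; intros f g HUV; [easy|].
intros Hg Hf. pose proof (diff_on_pred _ _ _ Hf) as Hf'.
destruct Hf as [Hf0 Hf], Hg as [Hg0 Hg]; split.
- intros t Ht. apply ex_derive_comp; auto.
- apply (diff_on_ext _ _ (fun t => Derive f t * Derive g (f t)) _ HU).
  + intros t Ht. symmetry. apply Derive_comp; auto.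
  + apply diff_on_mult; auto.
Qed.

Lemma diff_on_Rinv (k : nat) : diff_on k (fun t => t <> 0) Rinv.
Proof.
assert (D : forall t, t <> 0 -> is_derive Rinv t (- 1 * (/ t * / t))).
{ intros t Ht. auto_derive; [easy | field; easy]. }
induction k as [|k IH]; [easy|]. split.
- intros t Ht. eexists. apply (D t Ht).
- apply (diff_on_ext _ _ (fun t => - 1 * (/ t * / t)) _ (open_neq 0)).
  + intros t Ht. symmetry. now apply is_derive_unique, D.
  + repeat apply diff_on_mult; auto using open_neq, diff_on_const.
Qed.

(** Bootstrapping for [g' = F(g)]: if [g] is [k] times differentiable, so is [F(g)], which is [g'],
    and [g] gains one order. This serves for the exponential, the cube root and local inverses. *)
Lemma smooth_on_autonomous (U V : R -> Prop) (F g : R -> R) :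
  open U -> (forall t, U t -> V (g t)) -> smooth_on V F ->
  (forall t, U t -> is_derive g t (F (g t))) -> smooth_on U g.
Proof.
intros HU HV HF D k. induction k as [|k IH]; [easy|]. split.
- intros t Ht. eexists. now apply D.
- apply (diff_on_ext _ _ (fun t => F (g t)) _ HU).
  + intros t Ht. symmetry. now apply is_derive_unique, D.
  + now apply (diff_on_comp _ V).
Qed.

Lemma smooth_on_subset (U V : R -> Prop) (f : R -> R) :
  (forall t, V t -> U t) -> smooth_on U f -> smooth_on V f.
Proof. intros H Hf k. now apply (diff_on_subset U). Qed.

Lemma smooth_on_ext (U : R -> Prop) (f g : R -> R) :
  open U -> (forall t, U t -> f t = g t) -> smooth_on U f -> smooth_on U g.
Proof. intros HU E Hf k. now apply (diff_on_ext _ _ f). Qed.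

Lemma smooth_on_const (U : R -> Prop) (c : R) : smooth_on U (fun _ => c).
Proof. intros k. apply diff_on_const. Qed.

Lemma smooth_on_id (U : R -> Prop) : open U -> smooth_on U (fun t => t).
Proof. intros HU k. now apply diff_on_id. Qed.

Lemma smooth_on_plus (U : R -> Prop) (f g : R -> R) :
  open U -> smooth_on U f -> smooth_on U g -> smooth_on U (fun t => f t + g t).
Proof. intros HU Hf Hg k. now apply diff_on_plus. Qed.

Lemma smooth_on_mult (U : R -> Prop) (f g : R -> R) :
  open U -> smooth_on U f -> smooth_on U g -> smooth_on U (fun t => f t * g t).
Proof. intros HU Hf Hg k. now apply diff_on_mult. Qed.

Lemma smooth_on_opp (U : R -> Prop) (f : R -> R) :
  open U -> smooth_on U f -> smooth_on U (fun t => - f t).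
Proof.
intros HU Hf. apply (smooth_on_ext _ (fun t => -1 * f t) _ HU).
- intros t _. ring.
- apply smooth_on_mult; auto using smooth_on_const.
Qed.

Lemma smooth_on_minus (U : R -> Prop) (f g : R -> R) :
  open U -> smooth_on U f -> smooth_on U g -> smooth_on U (fun t => f t - g t).
Proof.
intros HU Hf Hg. apply (smooth_on_plus U f (fun t => - g t) HU Hf).
now apply smooth_on_opp.
Qed.

Lemma smooth_on_comp (U V : R -> Prop) (f g : R -> R) :
  open U -> (forall t, U t -> V (f t)) ->
  smooth_on V g -> smooth_on U f -> smooth_on U (fun t => g (f t)).
Proof. intros HU HV Hg Hf k. now apply (diff_on_comp _ V). Qed.

Lemma smooth_on_inv (U : R -> Prop) (f : R -> R) :
  open U -> (forall t, U t -> f t <> 0) ->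
  smooth_on U f -> smooth_on U (fun t => / f t).
Proof.
intros HU H0 Hf. apply (smooth_on_comp _ (fun t => t <> 0)); auto.
intros k. apply diff_on_Rinv.
Qed.

Lemma smooth_on_div (U : R -> Prop) (f g : R -> R) :
  open U -> (forall t, U t -> g t <> 0) ->
  smooth_on U f -> smooth_on U g -> smooth_on U (fun t => f t / g t).
Proof.
intros HU H0 Hf Hg. apply (smooth_on_mult U f (fun t => / g t) HU Hf).
now apply smooth_on_inv.
Qed.

Lemma smooth_on_pow (U : R -> Prop) (n : nat) (f : R -> R) :
  open U -> smooth_on U f -> smooth_on U (fun t => f t ^ n).
Proof.
intros HU Hf. induction n as [|n IH]; simpl.
- apply smooth_on_const.
- now apply smooth_on_mult.
Qed.

Lemma smooth_on_Derive (U : R -> Prop) (f : R -> R) :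
  smooth_on U f -> smooth_on U (Derive f).
Proof. intros Hf k. apply (Hf (S k)). Qed.

Lemma smooth_on_Derive_n (U : R -> Prop) (n : nat) (f : R -> R) :
  smooth_on U f -> smooth_on U (Derive_n f n).
Proof.
intros Hf. induction n as [|n IH]; [exact Hf|]. now apply smooth_on_Derive.
Qed.

Lemma smooth_on_is_derive (U : R -> Prop) (f : R -> R) (t : R) :
  smooth_on U f -> U t -> is_derive f t (Derive f t).
Proof. intros Hf Ht. apply Derive_correct. now apply (Hf 1%nat). Qed.

Lemma smooth_on_Rpower (p : R) :
  smooth_on (fun x => 0 < x) (fun x => Rpower x p).
Proof.
assert (Hexp : smooth_on (fun _ => True) exp).
{ apply (smooth_on_autonomous _ (fun _ => True) (fun x => x)); auto using open_true.
  - apply smooth_on_id, open_true.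
  - intros t _. apply is_derive_exp. }
assert (Hln : smooth_on (fun x => 0 < x) ln).
{ intros [|k]; [easy|]. split.
  - intros t Ht. eexists. now apply is_derive_ln.
  - apply (diff_on_ext _ _ Rinv _ (open_gt 0)).
    + intros t Ht. symmetry. now apply is_derive_unique, is_derive_ln.
    + apply (diff_on_subset (fun t => t <> 0)); [intros t Ht; lra|].
      apply diff_on_Rinv. }
apply (smooth_on_comp _ (fun _ => True) (fun x => p * ln x) exp); auto using open_gt.
apply smooth_on_mult; auto using open_gt, smooth_on_const.
Qed.

(** * Real cube roots *)

Lemma cbrt_neq_0 (x : R) : x <> 0 -> cbrt x <> 0.
Proof. intros Hx E. apply Hx. rewrite <- (cbrt_cube x), E. ring. Qed.

Lemma cube_inj (a b : R) : a ^ 3 = b ^ 3 -> a = b.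
Proof.
intros H.
assert (F : (a - b) * (a ^ 2 + a * b + b ^ 2) = 0).
{ transitivity (a ^ 3 - b ^ 3); [ring | lra]. }
apply Rmult_integral in F as [F | F]; [lra|].
(* The quadratic factor is [(a + b/2)^2 + 3/4 b^2]; it vanishes only when both squares do. *)
assert (Rsqr (a + b / 2) + Rsqr b = 0 -> a = b).
{ intros E. apply Rplus_sqr_eq_0 in E. lra. }
apply H0, Rle_antisym; unfold Rsqr; nra.
Qed.

Lemma cbrt_unique (a x : R) : a ^ 3 = x -> cbrt x = a.
Proof. intros H. apply cube_inj. now rewrite cbrt_cube. Qed.

(** One derivative is obtained from [Rpower] on the positive side and from oddness on the negative
    side. Differentiating [cbrt x ^ 3 = x] then gives the autonomous equation [c' = 1 / (3 c^2)]. *)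
Lemma smooth_on_cbrt : smooth_on (fun x => x <> 0) cbrt.
Proof.
assert (D0 : forall x, 0 < x -> ex_derive cbrt x).
{ intros x Hx. apply (ex_derive_ext_loc (fun u => Rpower u (1 / 3))).
  - apply (filter_imp (fun u => 0 < u)); [|now apply open_gt].
    intros u Hu. unfold cbrt.
    now rewrite (sign_eq_1 u Hu), Rabs_pos_eq, Rmult_1_l by lra.
  - apply (smooth_on_Rpower (1 / 3) 1%nat). exact Hx. }
assert (D1 : forall x, x <> 0 -> ex_derive cbrt x).
{ intros x Hx. destruct (Rlt_or_le 0 x) as [Hp | Hn]; [now apply D0|].
  apply (ex_derive_ext (fun u => - cbrt (- u))).
  - intros u. symmetry. apply cbrt_unique.
    transitivity (- cbrt (- u) ^ 3); [ring|]. rewrite cbrt_cube. apply Ropp_involutive.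
  - apply (ex_derive_opp (fun u => cbrt (- u))).
    apply (ex_derive_comp cbrt Ropp); [apply D0; lra | auto_derive; easy]. }
apply (smooth_on_autonomous _ (fun x => x <> 0) (fun c => / (3 * c ^ 2)));
  auto using open_neq, cbrt_neq_0.
- apply smooth_on_inv; [apply open_neq | | ].
  + intros c Hc. pose proof (pow_nonzero c 2 Hc). lra.
  + apply smooth_on_mult; auto using open_neq, smooth_on_const.
    apply smooth_on_pow; auto using open_neq, smooth_on_id.
- intros x Hx. pose proof (Derive_correct _ _ (D1 x Hx)) as D.
  assert (E : 3 * cbrt x ^ 2 * Derive cbrt x = 1).
  { transitivity (Derive (fun u => cbrt u ^ 3) x).
    - symmetry. apply is_derive_unique. auto_derive; [auto|].
      change (Derive (fun x0 => cbrt x0) x) with (Derive cbrt x). ring.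
    - rewrite (Derive_ext _ (fun u => u)); [apply Derive_id | apply cbrt_cube]. }
  pose proof (cbrt_neq_0 x Hx).
  replace (/ (3 * cbrt x ^ 2)) with (Derive cbrt x); [exact D|].
  field_simplify_eq; [lra | easy].
Qed.

(** * Smooth local inverses *)

Lemma increasing_local_inverse (f : R -> R) (lo hi : R) :
  lo < hi ->
  (forall t, lo <= t <= hi -> ex_derive f t) ->
  (forall t, lo <= t <= hi -> 0 < Derive f t) ->
  exists g : R -> R,
    (forall t, lo < t < hi -> f lo < f t < f hi /\ g (f t) = t) /\
    (forall v, f lo < v < f hi ->
       lo < g v < hi /\ f (g v) = v /\ is_derive g v (/ Derive f (g v))).
Proof.
intros Hlh Hex Hpos.
assert (Hinc : forall s t, lo <= s -> s < t -> t <= hi -> f s < f t).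
{ intros s t Hs Hst Ht.
  destruct (MVT_gen f s t (Derive f)) as [c [Hc E]].
  - rewrite Rmin_left, Rmax_right by lra.
    intros u Hu. apply Derive_correct, Hex. lra.
  - rewrite Rmin_left, Rmax_right by lra. intros u Hu.
    apply continuity_pt_filterlim, (ex_derive_continuous f), Hex. lra.
  - rewrite Rmin_left, Rmax_right in Hc by lra.
    assert (0 < Derive f c) by (apply Hpos; lra). nra. }
assert (Hcont : forall t, lo <= t <= hi -> continuity_pt f t).
{ intros t Ht. apply continuity_pt_filterlim, (ex_derive_continuous f), Hex, Ht. }
(* The conclusion is conditional, so the witnesses form a total function of [v]; [lo] and [hi] also
   serve as default values outside the range. *)
assert (Hsurj : forall v, {t | f lo <= v <= f hi -> lo <= t <= hi /\ f t = v}).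
{ intros v.
  destruct (Rlt_dec (f lo) v) as [H1|H1]; [destruct (Rlt_dec v (f hi)) as [H2|H2]|].
  - destruct (IVT_interv (fun t => f t - v) lo hi) as [t [Ht E]]; try lra.
    + intros a Ha. apply continuity_pt_minus; [now apply Hcont|].
      apply continuity_pt_const. now intros ? ?.
    + exists t. intros _. split; [lra|lra].
  - exists hi. intros H. split; lra.
  - exists lo. intros H. split; lra. }
pose (g := fun v => proj1_sig (Hsurj v)).
assert (Hg : forall v, f lo <= v <= f hi -> lo <= g v <= hi /\ f (g v) = v)
  by exact (fun v => proj2_sig (Hsurj v)).
clearbody g.
assert (Hin : forall v, f lo < v < f hi -> lo < g v < hi).
{ intros v Hv. destruct (Hg v) as [H E]; [lra|].
  split; apply Rnot_le_lt; intros C;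
    [assert (g v = lo) as C' by lra | assert (g v = hi) as C' by lra];
    rewrite C' in E; lra. }
exists g. split.
- intros t Ht.
  assert (f lo < f t < f hi) by (split; apply Hinc; lra).
  split; [easy|]. destruct (Hg (f t)) as [H1 E]; [lra|].
  destruct (Rtotal_order (g (f t)) t) as [C|[C|C]]; [|easy|].
  + apply Hinc in C; lra.
  + apply Hinc in C; lra.
- intros v Hv. split; [now apply Hin|]. destruct (Hg v) as [H1 E]; [lra|].
  split; [easy|].
  (* [derivable_pt_lim_recip_interv] works on a closed interval around [v]; midpoints between [v]
     and the ends of the range keep it inside the open range. *)
  assert (Hd : forall a, g ((f lo + v) / 2) <= a <= g ((v + f hi) / 2) -> derivable_pt f a).
  { intros a Ha. apply ex_derive_Reals_0, Hex.
    destruct (Hin ((f lo + v) / 2)); [lra|]. destruct (Hin ((v + f hi) / 2)); [lra|]. lra. }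
  assert (Hmono : forall u u', f lo < u -> u <= u' -> u' < f hi -> g u <= g u').
  { intros u u' Hu Huu Hu'. apply Rnot_lt_le. intros C.
    destruct (Hg u) as [? ?]; [lra|]. destruct (Hg u') as [? ?]; [lra|].
    apply Hinc in C; lra. }
  assert (Hm : g ((f lo + v) / 2) <= g v <= g ((v + f hi) / 2)).
  { split; apply Hmono; lra. }
  apply is_derive_Reals.
  pose proof (derivable_pt_lim_recip_interv f g ((f lo + v) / 2) ((v + f hi) / 2) v Hd) as L.
  assert (Hgc : continuity_pt g v).
  { apply (continuity_pt_recip_interv f g lo hi); try easy.
    - intros u Hu Hu'. unfold comp, id. now apply Hg.
    - intros u Hu Hu'. now apply Hg. }
  specialize (L Hgc ltac:(lra) ltac:(lra) Hm).
  assert (Hid : forall u, (f lo + v) / 2 <= u <= (v + f hi) / 2 -> comp f g u = id u).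
  { intros u Hu. unfold comp, id. apply Hg. lra. }
  specialize (L Hid). rewrite Derive_Reals in L.
  assert (0 < Derive f (g v)) by now apply Hpos.
  replace (/ Derive f (g v)) with (1 / Derive f (g v)) by (field; lra).
  apply L. lra.
Qed.

(** Near [t0] the sign of [f'] is constant. For positive sign the inverse of the monotone function
    satisfies [g' = 1 / f'(g)], hence is smooth; the negative case is reflected to [- f]. *)
Lemma smooth_local_inverse (U : R -> Prop) (f : R -> R) (t0 : R) :
  open U -> U t0 -> smooth_on U f -> Derive f t0 <> 0 ->
  exists (W V : R -> Prop) (g : R -> R),
    open W /\ open V /\ W t0 /\ (forall t, W t -> U t) /\
    (forall t, W t -> V (f t) /\ g (f t) = t) /\
    (forall v, V v -> W (g v) /\ f (g v) = v) /\ smooth_on V g.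
Proof.
assert (P : forall f : R -> R, open U -> U t0 -> smooth_on U f -> 0 < Derive f t0 ->
  exists (W V : R -> Prop) (g : R -> R),
    open W /\ open V /\ W t0 /\ (forall t, W t -> U t) /\
    (forall t, W t -> V (f t) /\ g (f t) = t) /\
    (forall v, V v -> W (g v) /\ f (g v) = v) /\ smooth_on V g).
{ clear f. intros f HU Ht0 Hf Hpos.
  assert (L : locally t0 (fun t => U t /\ 0 < Derive f t)).
  { apply filter_and; [now apply HU|].
    assert (C : continuous (Derive f) t0).
    { apply (ex_derive_continuous (Derive f)). now apply (Hf 2%nat). }
    apply C. now apply open_gt. }
  destruct L as [e He].
  assert (B : forall t, t0 - e / 2 <= t <= t0 + e / 2 -> U t /\ 0 < Derive f t).
  { intros t Ht. apply He. apply Rabs_lt_between'. pose proof (cond_pos e). lra. }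
  pose proof (cond_pos e) as He0.
  destruct (increasing_local_inverse f (t0 - e / 2) (t0 + e / 2)) as [g [G1 G2]].
  - lra.
  - intros t Ht. apply (Hf 1%nat). now apply B.
  - intros t Ht. now apply B.
  - exists (fun t => t0 - e / 2 < t < t0 + e / 2),
      (fun v => f (t0 - e / 2) < v < f (t0 + e / 2)), g.
    assert (HV : open (fun v => f (t0 - e / 2) < v < f (t0 + e / 2))).
    { apply open_and; [apply open_gt | apply open_lt]. }
    assert (HW : open (fun t => t0 - e / 2 < t < t0 + e / 2)).
    { apply open_and; [apply open_gt | apply open_lt]. }
    split; [exact HW|]. split; [exact HV|]. split; [lra|].
    split; [intros t Ht; apply B; lra|]. split; [exact G1|].
    split; [intros v Hv; destruct (G2 v Hv) as (? & ? & _); now split|].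
    apply (smooth_on_autonomous _ (fun t => t0 - e / 2 < t < t0 + e / 2)
             (fun t => / Derive f t) g HV).
    + intros v Hv. now apply G2.
    + apply smooth_on_inv; [exact HW | |].
      * intros t Ht. destruct (B t); lra.
      * apply smooth_on_Derive. apply (smooth_on_subset U); [|easy].
        intros t Ht. apply B. lra.
    + intros v Hv. now apply G2. }
intros HU Ht0 Hf Hn. destruct (Rlt_or_le 0 (Derive f t0)) as [Hp | Hp]; [now apply P|].
destruct (P (fun t => - f t)) as (W & V & g & HW & HV & H0 & HWU & H1 & H2 & Hg);
  auto using smooth_on_opp.
{ rewrite Derive_opp. lra. }
assert (HV' : open (fun v => V (- v))).
{ apply (open_comp Ropp); [|easy]. intros v _.
  apply (ex_derive_continuous Ropp). auto_derive. easy. }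
exists W, (fun v => V (- v)), (fun v => g (- v)).
do 4 (split; [easy|]). split; [exact H1|]. split.
- intros v Hv. destruct (H2 _ Hv) as [? E]. split; [easy | lra].
- apply (smooth_on_comp _ V Ropp g); auto. apply smooth_on_opp, smooth_on_id; easy.
Qed.

(** * The centro-equi-affine frame *)

Lemma cbrt_pow_neg1 (x : R) : cbrt_pow x (-1) = / cbrt x.
Proof. unfold cbrt_pow. simpl. now rewrite Rmult_1_r. Qed.

(** Turns half-integer powers of [kappa] into integer powers of its square root, which [field] can
    handle. *)
Lemma Rpower_sqrt_pow (x : R) (n : nat) : 0 < x -> Rpower x (INR n / 2) = sqrt x ^ n.
Proof.
intros Hx. rewrite <- Rpower_pow by now apply sqrt_lt_R0.
rewrite <- Rpower_sqrt, Rpower_mult by easy. f_equal. field.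
Qed.

Definition regular_on (U : R -> Prop) (w : R -> vec3) : Prop :=
  open U /\ smooth_on U (fun t => vx (w t)) /\ smooth_on U (fun t => vy (w t)) /\
  smooth_on U (fun t => vz (w t)) /\ forall t, U t -> w_Delta w t <> 0.

Ltac smooth :=
  repeat first
    [ assumption
    | apply smooth_on_const
    | apply smooth_on_id
    | apply smooth_on_minus
    | apply smooth_on_plus
    | apply smooth_on_div
    | apply smooth_on_mult
    | apply smooth_on_opp
    | apply smooth_on_pow
    | apply smooth_on_inv ].

Lemma smooth_on_det3 (U : R -> Prop) (p q r : R -> vec3) :
  open U ->
  smooth_on U (fun t => vx (p t)) -> smooth_on U (fun t => vy (p t)) ->
  smooth_on U (fun t => vz (p t)) ->
  smooth_on U (fun t => vx (q t)) -> smooth_on U (fun t => vy (q t)) ->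
  smooth_on U (fun t => vz (q t)) ->
  smooth_on U (fun t => vx (r t)) -> smooth_on U (fun t => vy (r t)) ->
  smooth_on U (fun t => vz (r t)) ->
  smooth_on U (fun t => det3 (p t) (q t) (r t)).
Proof. intros. unfold det3, dot3, cross3; simpl. smooth. Qed.

Lemma smooth_on_cbrt_Delta (U : R -> Prop) (w : R -> vec3) :
  regular_on U w -> smooth_on U (fun t => cbrt (w_Delta w t)).
Proof.
intros (HU & Hx & Hy & Hz & HD).
apply (smooth_on_comp _ (fun x => x <> 0) (w_Delta w) cbrt); auto using smooth_on_cbrt.
pose proof (fun f => smooth_on_Derive U f) as HS.
apply (smooth_on_det3 U w (Dvec w) (Dvec (Dvec w))); auto;
  repeat apply HS; assumption.
Qed.

Lemma smooth_on_Ds (U : R -> Prop) (w : R -> vec3) (f : R -> R) :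
  regular_on U w -> smooth_on U f -> smooth_on U (Ds w f).
Proof.
intros Hw Hf. pose proof (smooth_on_cbrt_Delta _ _ Hw).
pose proof Hw as (HU & _ & _ & _ & HD).
apply (smooth_on_ext _ (fun t => / cbrt (w_Delta w t) * Derive f t) _ HU).
- intros t Ht. unfold Ds. now rewrite cbrt_pow_neg1.
- smooth; [|now apply smooth_on_Derive]. intros t Ht. now apply cbrt_neq_0, HD.
Qed.

(** The factor [ds/dt = cbrt (w_Delta w t)] stays separate, so that computations in arc length can
    be run as derivatives in the parameter. *)
Lemma is_derive_Ds (U : R -> Prop) (w : R -> vec3) (f : R -> R) (t : R) :
  regular_on U w -> smooth_on U f -> U t ->
  is_derive f t (cbrt (w_Delta w t) * Ds w f t).
Proof.
intros Hw Hf Ht. destruct Hw as (_ & _ & _ & _ & HD).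
unfold Ds. rewrite cbrt_pow_neg1.
replace (cbrt (w_Delta w t) * (/ cbrt (w_Delta w t) * Derive f t)) with (Derive f t).
- now apply (smooth_on_is_derive U).
- field. now apply cbrt_neq_0, HD.
Qed.

Lemma Ds_of_is_derive (U : R -> Prop) (w : R -> vec3) (f : R -> R) (t l : R) :
  regular_on U w -> U t ->
  is_derive f t (cbrt (w_Delta w t) * l) -> Ds w f t = l.
Proof.
intros (_ & _ & _ & _ & HD) Ht H. unfold Ds.
rewrite cbrt_pow_neg1, (is_derive_unique _ _ _ H). field. now apply cbrt_neq_0, HD.
Qed.

Lemma smooth_on_w_ders (U : R -> Prop) (w : R -> vec3) :
  regular_on U w ->
  (smooth_on U (fun t => vx (w_s w t)) /\ smooth_on U (fun t => vy (w_s w t)) /\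
   smooth_on U (fun t => vz (w_s w t))) /\
  (smooth_on U (fun t => vx (w_ss w t)) /\ smooth_on U (fun t => vy (w_ss w t)) /\
   smooth_on U (fun t => vz (w_ss w t))) /\
  (smooth_on U (fun t => vx (w_sss w t)) /\ smooth_on U (fun t => vy (w_sss w t)) /\
   smooth_on U (fun t => vz (w_sss w t))).
Proof.
intros Hw. pose proof (fun f => smooth_on_Ds U w f Hw) as HS.
pose proof Hw as (_ & Hx & Hy & Hz & _).
repeat split; repeat apply HS; assumption.
Qed.

Lemma smooth_on_kappa (U : R -> Prop) (w : R -> vec3) :
  regular_on U w -> smooth_on U (kappa w).
Proof.
intros Hw. pose proof (smooth_on_w_ders U w Hw) as H.
pose proof Hw as (HU & Hx & Hy & Hz & _).
apply (smooth_on_det3 U w (w_ss w) (w_sss w)); tauto.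
Qed.

Lemma smooth_on_tau (U : R -> Prop) (w : R -> vec3) :
  regular_on U w -> smooth_on U (tau w).
Proof.
intros Hw. pose proof (smooth_on_w_ders U w Hw) as H.
pose proof Hw as (HU & Hx & Hy & Hz & _).
apply (smooth_on_det3 U (w_s w) (w_ss w) (w_sss w)); tauto.
Qed.

(** [auto_derive] leaves [Derive] terms for the unknown functions; these are replaced by the values
    given by the [is_derive] hypotheses. The [change] retypes the equation over [R] for [ring] and
    [field]. *)
Ltac derive_from_context :=
  auto_derive;
  [ repeat split; try assumption; try (eexists; eassumption)
  | match goal with |- @eq _ ?a ?b => change (@eq R a b) end;
    repeat match goal with
    | H : is_derive ?f ?t ?l |- _ =>
        rewrite ?(is_derive_unique (fun x : R => f x) t l H); clear H
    end ].

Lemma is_derive_det3 (p q r : R -> vec3) (p' q' r' : vec3) (t : R) :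
  is_derive (fun u => vx (p u)) t (vx p') ->
  is_derive (fun u => vy (p u)) t (vy p') ->
  is_derive (fun u => vz (p u)) t (vz p') ->
  is_derive (fun u => vx (q u)) t (vx q') ->
  is_derive (fun u => vy (q u)) t (vy q') ->
  is_derive (fun u => vz (q u)) t (vz q') ->
  is_derive (fun u => vx (r u)) t (vx r') ->
  is_derive (fun u => vy (r u)) t (vy r') ->
  is_derive (fun u => vz (r u)) t (vz r') ->
  is_derive (fun u => det3 (p u) (q u) (r u)) t
    (det3 p' (q t) (r t) + det3 (p t) q' (r t) + det3 (p t) (q t) r').
Proof.
(* With scalar functions as entries [auto_derive] applies; the vector form is convertible to this
   one, since [det3] reads only coordinates. *)
assert (G : forall a1 a2 a3 b1 b2 b3 c1 c2 c3 a1' a2' a3' b1' b2' b3' c1' c2' c3',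
  is_derive a1 t a1' -> is_derive a2 t a2' -> is_derive a3 t a3' ->
  is_derive b1 t b1' -> is_derive b2 t b2' -> is_derive b3 t b3' ->
  is_derive c1 t c1' -> is_derive c2 t c2' -> is_derive c3 t c3' ->
  is_derive
    (fun u => det3 (Vec3 (a1 u) (a2 u) (a3 u)) (Vec3 (b1 u) (b2 u) (b3 u))
                (Vec3 (c1 u) (c2 u) (c3 u))) t
    (det3 (Vec3 a1' a2' a3') (Vec3 (b1 t) (b2 t) (b3 t)) (Vec3 (c1 t) (c2 t) (c3 t))
     + det3 (Vec3 (a1 t) (a2 t) (a3 t)) (Vec3 b1' b2' b3') (Vec3 (c1 t) (c2 t) (c3 t))
     + det3 (Vec3 (a1 t) (a2 t) (a3 t)) (Vec3 (b1 t) (b2 t) (b3 t))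
         (Vec3 c1' c2' c3'))).
{ intros * A1 A2 A3 B1 B2 B3 C1 C2 C3. unfold det3, dot3, cross3; cbn [vx vy vz].
  derive_from_context. ring. }
intros H1 H2 H3 H4 H5 H6 H7 H8 H9.
exact (G _ _ _ _ _ _ _ _ _ _ _ _ _ _ _ _ _ _ H1 H2 H3 H4 H5 H6 H7 H8 H9).
Qed.

(** * Normalization of the frame and its Frenet equation *)

(** With [c = ds/dt], [w_s] is [w_t / c] and [w_ss] is [w_tt / c^2] plus a multiple of [w_t], which
    the determinant ignores. What remains is [w_Delta / c^3]. *)
Lemma det3_w_ws_wss (U : R -> Prop) (w : R -> vec3) (t : R) :
  regular_on U w -> U t -> det3 (w t) (w_s w t) (w_ss w t) = 1.
Proof.
intros Hw Ht. pose proof (smooth_on_cbrt_Delta _ _ Hw) as Hc.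
pose proof Hw as (HU & Hx & Hy & Hz & HD).
pose proof (cbrt_neq_0 _ (HD t Ht)) as H0.
pose (c := fun t => cbrt (w_Delta w t)).
assert (S2 : forall f, smooth_on U f ->
  Ds w (Ds w f) t = (Derive (Derive f) t / c t - Derive f t * Derive c t / c t ^ 2) / c t).
{ intros f Hf. apply (Ds_of_is_derive U); auto. fold (c t).
  apply (is_derive_ext_loc (fun t => Derive f t / c t)).
  - apply (filter_imp U); [|now apply HU]. intros u Hu. unfold Ds.
    rewrite cbrt_pow_neg1. apply Rmult_comm.
  - pose proof (smooth_on_is_derive _ _ _ (smooth_on_Derive _ _ Hf) Ht) as D1.
    pose proof (smooth_on_is_derive _ _ _ Hc Ht) as D2. fold c in D2.
    auto_derive.
    + repeat split; try exact H0; eexists; eassumption.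
    + change (Derive (fun x : R => c x) t) with (Derive c t).
      change (Derive (fun x : R => Derive f x) t) with (Derive (Derive f) t).
      field. exact H0. }
pose proof (S2 _ Hx) as Ex. pose proof (S2 _ Hy) as Ey. pose proof (S2 _ Hz) as Ez.
change (Ds w (Ds w (fun t => vx (w t))) t) with (vx (w_ss w t)) in Ex.
change (Ds w (Ds w (fun t => vy (w t))) t) with (vy (w_ss w t)) in Ey.
change (Ds w (Ds w (fun t => vz (w t))) t) with (vz (w_ss w t)) in Ez.
apply Rmult_eq_reg_l with (c t ^ 3); [|now apply pow_nonzero].
rewrite Rmult_1_r. transitivity (w_Delta w t); [|symmetry; apply cbrt_cube].
unfold w_Delta, det3, dot3, cross3; cbn [vx vy vz]. rewrite Ex, Ey, Ez.
unfold w_s, Ds_vec, scale3, Dvec; cbn [vx vy vz]. rewrite cbrt_pow_neg1. fold (c t).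
change (fun t => Derive (fun u => vx (w u)) t) with (Derive (fun u => vx (w u))).
change (fun t => Derive (fun u => vy (w u)) t) with (Derive (fun u => vy (w u))).
change (fun t => Derive (fun u => vz (w u)) t) with (Derive (fun u => vz (w u))).
field. exact H0.
Qed.

(** Differentiate [[w, w_s, w_ss] = 1]: the other two terms of the product rule have a repeated
    row. *)
Lemma det3_w_ws_wsss (U : R -> Prop) (w : R -> vec3) (t : R) :
  regular_on U w -> U t -> det3 (w t) (w_s w t) (w_sss w t) = 0.
Proof.
intros Hw Ht.
pose proof (smooth_on_w_ders U w Hw)
  as ((S1x & S1y & S1z) & (S2x & S2y & S2z) & _).
pose proof Hw as (HU & Hx & Hy & Hz & HD).
pose proof (fun f Hf => is_derive_Ds U w f t Hw Hf Ht) as D.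
pose (k := fun v => scale3 (cbrt (w_Delta w t)) v).
pose proof (is_derive_det3 w (w_s w) (w_ss w) (k (w_s w t)) (k (w_ss w t))
  (k (w_sss w t)) t (D _ Hx) (D _ Hy) (D _ Hz) (D _ S1x) (D _ S1y) (D _ S1z)
  (D _ S2x) (D _ S2y) (D _ S2z)) as E.
apply is_derive_unique in E. rewrite (Derive_ext_loc _ (fun _ => 1)), Derive_const in E.
- apply Rmult_eq_reg_l with (cbrt (w_Delta w t)); [|now apply cbrt_neq_0, HD].
  rewrite Rmult_0_r, E. unfold k, det3, dot3, cross3, scale3; cbn [vx vy vz]. ring.
- apply (filter_imp U); [|now apply HU]. intros u Hu. now apply (det3_w_ws_wss U).
Qed.

(* Cramer's rule in the frame w, w_s, w_ss, whose determinant is 1. *)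
Lemma w_sss_frame (U : R -> Prop) (w : R -> vec3) (t : R) :
  regular_on U w -> U t ->
  vx (w_sss w t) = tau w t * vx (w t) - kappa w t * vx (w_s w t) /\
  vy (w_sss w t) = tau w t * vy (w t) - kappa w t * vy (w_s w t) /\
  vz (w_sss w t) = tau w t * vz (w t) - kappa w t * vz (w_s w t).
Proof.
intros Hw Ht. pose proof (det3_w_ws_wss U w t Hw Ht) as E1.
pose proof (det3_w_ws_wsss U w t Hw Ht) as E0.
unfold tau, kappa.
destruct (w t) as [a1 a2 a3], (w_s w t) as [b1 b2 b3], (w_ss w t) as [c1 c2 c3],
  (w_sss w t) as [d1 d2 d3].
unfold det3, dot3, cross3 in *; cbn [vx vy vz] in *.
repeat split.
(* Once [1] and [0] are replaced by the two determinants, the claim is a polynomial identity in the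
   entries of the four vectors. *)
- transitivity (1 * d1 - 0 * c1); [ring|]. rewrite <- E1, <- E0. ring.
- transitivity (1 * d2 - 0 * c2); [ring|]. rewrite <- E1, <- E0. ring.
- transitivity (1 * d3 - 0 * c3); [ring|]. rewrite <- E1, <- E0. ring.
Qed.

(* With [c t = ds/dt], the equation [f' = c / z * g] says that g is the derivative of f
   along the arc length of the projected curve, since d chi = ds / z. *)
Lemma projection_chi_derivatives (c x xs xss z zs zss k ta : R -> R) (t : R) :
  z t <> 0 ->
  is_derive x t (c t * xs t) -> is_derive xs t (c t * xss t) ->
  is_derive xss t (c t * (ta t * x t - k t * xs t)) ->
  is_derive z t (c t * zs t) -> is_derive zs t (c t * zss t) ->
  is_derive zss t (c t * (ta t * z t - k t * zs t)) ->
  let p1 := fun t => xs t - x t * zs t / z t in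
  is_derive (fun t => x t / z t) t (c t / z t * p1 t) /\
  let p2 := fun t => z t * xss t - zs t * xs t - (zss t - zs t ^ 2 / z t) * x t in
  is_derive p1 t (c t / z t * p2 t) /\
  is_derive p2 t
    (c t / z t * (- (k t * z t ^ 2 + 2 * z t * zss t - zs t ^ 2) * p1 t)).
Proof.
intros Hz Dx Dxs Dxss Dz Dzs Dzss. cbv zeta. split; [|split].
- derive_from_context. field. exact Hz.
- derive_from_context. field. exact Hz.
- derive_from_context. field. exact Hz.
Qed.

(** The hypothesis on [k] encodes [A = kappa_s + 2 tau]. In the first derivative the terms in [zs]
    and [zss] cancel, leaving [3 z^2 A]; the extra factor [z] comes from [D_chi = z D_s]. *)
Lemma affine_curvature_chi_derivatives (c z zs zss k ta A A1 : R -> R) (A2 t : R) :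
  z t <> 0 ->
  is_derive z t (c t * zs t) -> is_derive zs t (c t * zss t) ->
  is_derive zss t (c t * (ta t * z t - k t * zs t)) ->
  is_derive k t (c t * (A t - 2 * ta t)) ->
  is_derive A t (c t * A1 t) -> is_derive A1 t (c t * A2) ->
  let m1 := fun t => 3 * z t ^ 3 * A t in
  let m2 := fun t => 9 * z t ^ 3 * zs t * A t + 3 * z t ^ 4 * A1 t in
  is_derive (fun t => 3 * (k t * z t ^ 2 + 2 * z t * zss t - zs t ^ 2)) t
    (c t / z t * m1 t) /\
  is_derive m1 t (c t / z t * m2 t) /\
  is_derive m2 t
    (c t / z t * (27 * z t ^ 3 * zs t ^ 2 * A t + 9 * z t ^ 4 * zss t * A t
                  + 21 * z t ^ 4 * zs t * A1 t + 3 * z t ^ 5 * A2)).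
Proof.
intros Hz Dz Dzs Dzss Dk DA DA1. cbv zeta. split; [|split].
- derive_from_context. field. exact Hz.
- derive_from_context. field. exact Hz.
- derive_from_context. field. exact Hz.
Qed.

(* [r] is the square root of the curvature, so that [d sigma = r ds]. *)
Lemma s_derivatives_of_alpha (c r al a1 kh : R -> R) (a2 k1 t : R) :
  is_derive r t (c t * (kh t * r t ^ 2 / 2)) ->
  is_derive kh t (c t * r t * k1) ->
  is_derive al t (c t * r t * a1 t) -> is_derive a1 t (c t * r t * a2) ->
  let A1 := fun t => r t ^ 4 * (a1 t + 3 / 2 * kh t * al t) in
  is_derive (fun t => al t * r t ^ 3) t (c t * A1 t) /\
  is_derive A1 t
    (c t * (r t ^ 5 * (a2 + 7 / 2 * kh t * a1 t
                       + (3 / 2 * k1 + 3 * kh t ^ 2) * al t))).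
Proof.
intros Dr Dk Dal Da1. cbv zeta. split.
- derive_from_context. field.
- derive_from_context. field.
Qed.

(** The surviving factor [z^8] is the one that [m1^(8/3)] brings into the denominator of [eta], so
    [z] itself drops out too. *)
Lemma eta_numerator (z zs zss k A A1 A2 : R) :
  let M := 3 * (k * z ^ 2 + 2 * z * zss - zs ^ 2) in
  let m1 := 3 * z ^ 3 * A in
  let m2 := 9 * z ^ 3 * zs * A + 3 * z ^ 4 * A1 in
  let m3 := 27 * z ^ 3 * zs ^ 2 * A + 9 * z ^ 4 * zss * A
            + 21 * z ^ 4 * zs * A1 + 3 * z ^ 5 * A2 in
  6 * m3 * m1 - 7 * m2 ^ 2 - 3 * M * m1 ^ 2
  = z ^ 8 * (54 * A * A2 - 63 * A1 ^ 2 - 81 * k * A ^ 2).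
Proof. cbv zeta. ring. Qed.

(** * Projective curvature along a parametrized plane curve *)

(** Chain rule for [F(X) = G]. The common speed [h] cancels, so [X]-derivatives of [Y] are found
    without differentiating an inverse of [X]. *)
Lemma Derive_along_curve (W : R -> Prop) (X F G : R -> R) (t h p g : R) :
  open W -> W t -> (forall u, W u -> F (X u) = G u) -> ex_derive F (X t) ->
  h <> 0 -> p <> 0 -> is_derive X t (h * p) -> is_derive G t (h * g) ->
  Derive F (X t) = g / p.
Proof.
intros HW Ht HG HF Hh Hp DX DG.
assert (E : Derive (fun u => F (X u)) t = h * g).
{ apply is_derive_unique. apply (is_derive_ext_loc G); [|exact DG].
  apply (filter_imp W); [|now apply HW]. intros u Hu. now rewrite HG. }
rewrite Derive_comp, (is_derive_unique _ _ _ DX) in E; [|easy|now exists (h * p)].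
apply (Rmult_eq_reg_l (h * p)); [|now apply Rmult_integral_contrapositive].
rewrite E. field. exact Hp.
Qed.

Lemma smooth_on_Dchi (V : R -> Prop) (Y F : R -> R) :
  open V -> smooth_on V Y -> (forall v, V v -> Derive_n Y 2 v <> 0) ->
  smooth_on V F -> smooth_on V (Dchi Y F).
Proof.
intros HV HY H2 HF.
apply (smooth_on_ext _ (fun v => / cbrt (Derive_n Y 2 v) * Derive F v) _ HV).
- intros v _. unfold Dchi. now rewrite cbrt_pow_neg1.
- assert (smooth_on V (fun v => cbrt (Derive_n Y 2 v))).
  { apply (smooth_on_comp _ (fun x => x <> 0) (Derive_n Y 2) cbrt);
      auto using smooth_on_cbrt, smooth_on_Derive_n. }
  smooth; [|now apply smooth_on_Derive]. intros v Hv. now apply cbrt_neq_0, H2.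
Qed.

Lemma smooth_on_mu (V : R -> Prop) (Y : R -> R) :
  open V -> smooth_on V Y -> (forall v, V v -> Derive_n Y 2 v <> 0) ->
  smooth_on V (mu Y).
Proof.
intros HV HY H2. pose proof (fun n => smooth_on_Derive_n V n Y HY) as HS.
assert (smooth_on V (fun v => cbrt (Derive_n Y 2 v))).
{ apply (smooth_on_comp _ (fun x => x <> 0) (Derive_n Y 2) cbrt);
    auto using smooth_on_cbrt. }
change (mu Y) with (fun v => (3 * Derive_n Y 2 v * Derive_n Y 4 v
  - 5 * Derive_n Y 3 v ^ 2) / (3 * cbrt (Derive_n Y 2 v) ^ 8)).
pose proof (HS 2%nat). pose proof (HS 3%nat). pose proof (HS 4%nat).
smooth. intros v Hv. apply Rmult_integral_contrapositive; split; [lra|].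
now apply pow_nonzero, cbrt_neq_0, H2.
Qed.

(* [h = d chi / dt], and [p1, p2, q1, q2, m1, ...] are the successive
   chi-derivatives of the coordinates [p0, q0] and of the affine curvature [M],
   all as functions of the parameter of the curve. *)
Lemma eta_along_curve (W V : R -> Prop) (Y h p0 p1 p2 q0 q1 q2 M m1 m2 : R -> R)
    (m3 t : R) :
  open W -> open V -> smooth_on V Y -> W t ->
  (forall v, V v -> exists u, W u /\ p0 u = v) ->
  (forall u, W u -> V (p0 u) /\ Y (p0 u) = q0 u) ->
  (forall u, W u -> h u <> 0 /\ p1 u <> 0 /\ p1 u * q2 u - q1 u * p2 u = 1) ->
  (forall u, W u -> is_derive p0 u (h u * p1 u)) ->
  (forall u, W u -> is_derive p1 u (h u * p2 u)) ->
  (forall u, W u -> is_derive p2 u (h u * (- (M u / 3) * p1 u))) ->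
  (forall u, W u -> is_derive q0 u (h u * q1 u)) ->
  (forall u, W u -> is_derive q1 u (h u * q2 u)) ->
  (forall u, W u -> is_derive M u (h u * m1 u)) ->
  (forall u, W u -> is_derive m1 u (h u * m2 u)) ->
  is_derive m2 t (h t * m3) ->
  Derive_n Y 2 (p0 t) <> 0 /\ mu_chi Y (p0 t) = m1 t /\
  eta Y (p0 t) =
    (6 * m3 * m1 t - 7 * m2 t ^ 2 - 3 * M t * m1 t ^ 2) / (6 * cbrt_pow (m1 t) 8).
Proof.
intros HW HV HY Ht Hsurj HYq Hreg Dp0 Dp1 Dp2 Dq0 Dq1 DM Dm1 Dm2.
assert (Y1 : forall u, W u -> Derive_n Y 1 (p0 u) = q1 u / p1 u).
{ intros u Hu. destruct (Hreg u Hu) as (Hh & Hp & _).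
  apply (Derive_along_curve W p0 Y q0 u (h u)); auto; [intros; now apply HYq|].
  apply (HY 1%nat). now apply HYq. }
assert (SY : forall n u, W u -> ex_derive (Derive_n Y n) (p0 u)).
{ intros n u Hu. apply (smooth_on_Derive_n V n Y HY 1%nat). now apply HYq. }
assert (Y2 : forall u, W u -> Derive_n Y 2 (p0 u) = / p1 u ^ 3).
{ intros u Hu. destruct (Hreg u Hu) as (Hh & Hp & E).
  (* The numerator is the Wronskian of [p1] and [q1] with respect to chi, normalized to 1. *)
  transitivity ((p1 u * q2 u - q1 u * p2 u) / p1 u ^ 2 / p1 u); [|rewrite E; field; easy].
  apply (Derive_along_curve W p0 (Derive_n Y 1) (fun u => q1 u / p1 u) u (h u)); auto.
  pose proof (Dp1 u Hu). pose proof (Dq1 u Hu).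
  derive_from_context. field. easy. }
assert (Y3 : forall u, W u -> Derive_n Y 3 (p0 u) = - 3 * p2 u / p1 u ^ 5).
{ intros u Hu. destruct (Hreg u Hu) as (Hh & Hp & E).
  transitivity (- 3 * p2 u / p1 u ^ 4 / p1 u); [|field; easy].
  apply (Derive_along_curve W p0 (Derive_n Y 2) (fun u => / p1 u ^ 3) u (h u)); auto.
  pose proof (Dp1 u Hu).
  derive_from_context; [|field; easy]. now apply (pow_nonzero _ 3). }
(* Here [M] enters, through the derivative [- (M / 3) p1] of [p2]. *)
assert (Y4 : forall u, W u ->
  Derive_n Y 4 (p0 u) = (15 * p2 u ^ 2 + M u * p1 u ^ 2) / p1 u ^ 7).
{ intros u Hu. destruct (Hreg u Hu) as (Hh & Hp & E).
  transitivity ((15 * p2 u ^ 2 + M u * p1 u ^ 2) / p1 u ^ 6 / p1 u); [|field; easy].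
  apply (Derive_along_curve W p0 (Derive_n Y 3) (fun u => - 3 * p2 u / p1 u ^ 5)
           u (h u)); auto.
  pose proof (Dp1 u Hu). pose proof (Dp2 u Hu).
  derive_from_context; [|field; easy]. now apply (pow_nonzero _ 5). }
assert (C2 : forall u, W u -> cbrt (Derive_n Y 2 (p0 u)) = / p1 u).
{ intros u Hu. rewrite Y2 by easy. apply cbrt_unique. field. now apply Hreg. }
(* Smoothness of [mu Y] on [V] needs this at every point of [V], hence the surjectivity of [p0] onto
   [V]. *)
assert (N2 : forall v, V v -> Derive_n Y 2 v <> 0).
{ intros v Hv. destruct (Hsurj v Hv) as (u & Hu & <-). rewrite Y2 by easy.
  now apply Rinv_neq_0_compat, pow_nonzero, Hreg. }
(* The [p2^2] terms of [3 Y2 Y4] and [5 Y3^2] cancel. *)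
assert (Hmu : forall u, W u -> mu Y (p0 u) = M u).
{ intros u Hu. unfold mu. change (cbrt_pow ?x 8) with (cbrt x ^ 8).
  rewrite C2, Y2, Y3, Y4 by easy. field. now apply Hreg. }
(* The factor [Y2^(-1/3) = p1] of [Dchi] cancels the division by [p1] in the chain rule, so
   chi-derivatives are read off along the curve. *)
assert (Hchi : forall (F G : R -> R) g u, smooth_on V F -> W u ->
  (forall u, W u -> F (p0 u) = G u) -> is_derive G u (h u * g) ->
  Dchi Y F (p0 u) = g).
{ intros F G g u HF Hu HG DG. unfold Dchi. rewrite cbrt_pow_neg1, C2 by easy.
  destruct (Hreg u Hu) as (Hh & Hp & _).
  rewrite (Derive_along_curve W p0 F G u (h u) (p1 u) g); auto.
  - field. easy.
  - apply (HF 1%nat). now apply HYq. }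
pose proof (smooth_on_mu V Y HV HY N2) as S0.
pose proof (fun F => smooth_on_Dchi V Y F HV HY N2) as SD.
assert (H1 : forall u, W u -> mu_chi Y (p0 u) = m1 u).
{ intros u Hu. apply (Hchi (mu Y) M); auto. }
assert (H2 : forall u, W u -> mu_chichi Y (p0 u) = m2 u).
{ intros u Hu. apply (Hchi (mu_chi Y) m1); auto. now apply SD. }
assert (H3 : mu_chichichi Y (p0 t) = m3).
{ apply (Hchi (mu_chichi Y) m2); auto. now apply SD, SD. }
split; [|split]; auto.
- now apply N2, HYq.
- unfold eta. now rewrite H3, H2, H1, Hmu by easy.
Qed.

(** * Centro-affine invariants *)

Definition positively_curved_on (U : R -> Prop) (w : R -> vec3) : Prop :=
  regular_on U w /\ forall t, U t -> 0 < kappa w t.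

Lemma smooth_on_Rpower_kappa (U : R -> Prop) (w : R -> vec3) (p : R) :
  positively_curved_on U w -> smooth_on U (fun t => Rpower (kappa w t) p).
Proof.
intros [Hw Hk]. pose proof Hw as (HU & _).
apply (smooth_on_comp _ (fun x => 0 < x) (kappa w) (fun x => Rpower x p));
  auto using smooth_on_Rpower, smooth_on_kappa.
Qed.

Lemma smooth_on_Dsigma (U : R -> Prop) (w : R -> vec3) (f : R -> R) :
  positively_curved_on U w -> smooth_on U f -> smooth_on U (Dsigma w f).
Proof.
intros Hw Hf. apply (smooth_on_mult U _ (Ds w f)).
- apply Hw.
- now apply smooth_on_Rpower_kappa.
- apply smooth_on_Ds; [apply Hw | easy].
Qed.

Lemma smooth_on_kappa_hat (U : R -> Prop) (w : R -> vec3) :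
  positively_curved_on U w -> smooth_on U (kappa_hat w).
Proof.
intros Hw. apply (smooth_on_div U (Ds w (kappa w))).
- apply Hw.
- intros t _. apply Rgt_not_eq, exp_pos.
- apply smooth_on_Ds; [|apply smooth_on_kappa]; apply Hw.
- now apply smooth_on_Rpower_kappa.
Qed.

Lemma smooth_on_alpha_hat (U : R -> Prop) (w : R -> vec3) :
  positively_curved_on U w -> smooth_on U (alpha_hat w).
Proof.
intros Hw. assert (HU : open U) by apply Hw.
apply (smooth_on_plus U (kappa_hat w) (fun t => 2 * tau_hat w t) HU).
- now apply smooth_on_kappa_hat.
- apply smooth_on_mult; [easy | apply smooth_on_const |].
  apply (smooth_on_div U (tau w)); [easy | | |].
  + intros t _. apply Rgt_not_eq, exp_pos.
  + apply smooth_on_tau, Hw.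
  + now apply smooth_on_Rpower_kappa.
Qed.

Lemma Dsigma_eq (w : R -> vec3) (f : R -> R) (t : R) :
  0 < kappa w t -> Dsigma w f t = Ds w f t / sqrt (kappa w t).
Proof.
intros Hk. unfold Dsigma. replace (-1 / 2) with (- / 2) by lra.
rewrite Rpower_Ropp, Rpower_sqrt by easy. apply Rmult_comm.
Qed.

Lemma is_derive_Dsigma (U : R -> Prop) (w : R -> vec3) (f : R -> R) (t : R) :
  positively_curved_on U w -> smooth_on U f -> U t ->
  is_derive f t (cbrt (w_Delta w t) * sqrt (kappa w t) * Dsigma w f t).
Proof.
intros [Hw Hk] Hf Ht. pose proof (sqrt_lt_R0 _ (Hk t Ht)).
rewrite Dsigma_eq by auto.
replace (_ * _ * _) with (cbrt (w_Delta w t) * Ds w f t) by (field; lra).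
now apply (is_derive_Ds U).
Qed.

Lemma Dsigma_of_is_derive (U : R -> Prop) (w : R -> vec3) (f : R -> R) (t l : R) :
  positively_curved_on U w -> U t ->
  is_derive f t (cbrt (w_Delta w t) * sqrt (kappa w t) * l) -> Dsigma w f t = l.
Proof.
intros [Hw Hk] Ht D. pose proof (sqrt_lt_R0 _ (Hk t Ht)).
rewrite Dsigma_eq by auto. rewrite Rmult_assoc in D.
rewrite (Ds_of_is_derive U w f t _ Hw Ht D). field. lra.
Qed.

Lemma kappa_hat_sqrt (w : R -> vec3) (t : R) :
  0 < kappa w t -> Ds w (kappa w) t = kappa_hat w t * sqrt (kappa w t) ^ 3.
Proof.
intros Hk. pose proof (sqrt_lt_R0 _ Hk).
unfold kappa_hat. replace 3 with (INR 3) by (simpl; lra).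
rewrite Rpower_sqrt_pow by easy. field. lra.
Qed.

(** Solved for [kappa_s] in the shape [A - 2 tau], with [A = kappa^(3/2) alpha_hat], in which it is
    used for the affine curvature. *)
Lemma alpha_hat_sqrt (w : R -> vec3) (t : R) :
  0 < kappa w t ->
  Ds w (kappa w) t = alpha_hat w t * sqrt (kappa w t) ^ 3 - 2 * tau w t.
Proof.
intros Hk. pose proof (sqrt_lt_R0 _ Hk).
unfold alpha_hat, tau_hat. rewrite kappa_hat_sqrt by easy.
replace 3 with (INR 3) by (simpl; lra).
rewrite Rpower_sqrt_pow by easy. field. lra.
Qed.

Lemma is_derive_sqrt_kappa (U : R -> Prop) (w : R -> vec3) (t : R) :
  positively_curved_on U w -> U t ->
  is_derive (fun t => sqrt (kappa w t)) t
    (cbrt (w_Delta w t) * (kappa_hat w t * sqrt (kappa w t) ^ 2 / 2)).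
Proof.
intros [Hw Hk] Ht. pose proof (sqrt_lt_R0 _ (Hk t Ht)).
pose proof (is_derive_Ds U w _ t Hw (smooth_on_kappa U w Hw) Ht) as D.
rewrite kappa_hat_sqrt in D by auto.
pose proof (Hk t Ht).
derive_from_context. field. lra.
Qed.

Lemma cbrt_mult (a b : R) : cbrt (a * b) = cbrt a * cbrt b.
Proof.
apply cbrt_unique. rewrite Rpow_mult_distr, !cbrt_cube. reflexivity.
Qed.

(** Links the two forms of the result: for [p = -1/6] the factor [p - 1] is the coefficient
    [-7/6]. *)
Lemma Dsigma2_Rpower_alpha_hat (U : R -> Prop) (w : R -> vec3) (p t : R) :
  positively_curved_on U w -> U t -> 0 < alpha_hat w t ->
  Dsigma w (Dsigma w (fun t => Rpower (alpha_hat w t) p)) t =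
  p * Rpower (alpha_hat w t) p *
    (Dsigma w (Dsigma w (alpha_hat w)) t / alpha_hat w t
     + (p - 1) * Dsigma w (alpha_hat w) t ^ 2 / alpha_hat w t ^ 2).
Proof.
intros Hw Ht Hal. assert (HU : open U) by apply Hw.
pose proof (smooth_on_alpha_hat U w Hw) as S0.
pose proof (smooth_on_Dsigma U w _ Hw S0) as S1.
assert (D1 : forall u, U u -> 0 < alpha_hat w u ->
  is_derive (fun t => Rpower (alpha_hat w t) p) u
    (cbrt (w_Delta w u) * sqrt (kappa w u) *
     (p * Rpower (alpha_hat w u) p * Dsigma w (alpha_hat w) u / alpha_hat w u))).
{ intros u Hu Hp. pose proof (is_derive_Dsigma U w _ u Hw S0 Hu) as D.
  unfold Rpower. derive_from_context. field. lra. }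
apply (Dsigma_of_is_derive U); auto.
apply (is_derive_ext_loc
  (fun u => p * Rpower (alpha_hat w u) p * Dsigma w (alpha_hat w) u / alpha_hat w u)).
(* The outer derivative needs the inner formula on a neighbourhood; positivity of [alpha_hat]
   persists there by continuity. *)
- assert (L : locally t (fun u => U u /\ 0 < alpha_hat w u)).
  { apply filter_and; [now apply HU|].
    assert (C : continuous (alpha_hat w) t).
    { apply (ex_derive_continuous (alpha_hat w)). now apply (S0 1%nat). }
    apply C. now apply open_gt. }
  apply (filter_imp _ _ (fun u H => eq_sym (Dsigma_of_is_derive U w _ u _ Hw (proj1 H)
    (D1 u (proj1 H) (proj2 H)))) L).
(* The power enters only through its logarithmic derivative, so it can be replaced by an abstract
   [B]. *)
- assert (G : forall (B al a1 : R -> R) h a2, al t <> 0 ->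
    is_derive B t (h * (p * B t * a1 t / al t)) ->
    is_derive al t (h * a1 t) -> is_derive a1 t (h * a2) ->
    is_derive (fun u => p * B u * a1 u / al u) t
      (h * (p * B t * (a2 / al t + (p - 1) * a1 t ^ 2 / al t ^ 2)))).
  { intros B al a1 h a2 H0 DB Dal Da1. derive_from_context. field. easy. }
  apply (G (fun u => Rpower (alpha_hat w u) p)); auto.
  + lra.
  + now apply (is_derive_Dsigma U).
  + now apply (is_derive_Dsigma U).
Qed.

(** * Projective curvature of the projection of an arbitrarily parametrized curve *)

Definition projection_abscissa (w : R -> vec3) (t : R) : R := vx (w t) / vz (w t).

Theorem eta_of_projection (U : R -> Prop) (w : R -> vec3) (t : R) (Y : R -> R) :
  positively_curved_on U w -> U t ->
  (forall u, U u -> vz (w u) <> 0 /\ Derive (projection_abscissa w) u <> 0) ->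
  alpha_hat w t <> 0 -> is_projected_graph w t Y ->
  eta_defined Y (projection_abscissa w t) /\
  eta Y (projection_abscissa w t) =
    cbrt_pow 3 (-2) *
    (cbrt_pow (alpha_hat w t) (-5) * Dsigma w (Dsigma w (alpha_hat w)) t
     - 7 / 6 * cbrt_pow (alpha_hat w t) (-8) * Dsigma w (alpha_hat w) t ^ 2
     + 3 / 2 * cbrt_pow (alpha_hat w t) (-2) *
       (Dsigma w (kappa_hat w) t + 1 / 4 * kappa_hat w t ^ 2 - 1)).
Proof.
intros Hcw Ht Hproj Hal HY.
pose proof Hcw as [Hw Hk]. pose proof Hw as (HU & Sx & Sy & Sz & HD).
set (X := projection_abscissa w) in *.
pose (c := fun t => cbrt (w_Delta w t)).
(* [h] is [d chi / dt]; [p1], [p2], [q1], [q2] are the chi-derivatives of the projected coordinates,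
   and [A1], [A2] the s-derivatives of [A = kappa_s + 2 tau]. *)
pose (h := fun t => c t / vz (w t)).
pose (p1 := fun t => vx (w_s w t) - vx (w t) * vz (w_s w t) / vz (w t)).
pose (p2 := fun t => vz (w t) * vx (w_ss w t) - vz (w_s w t) * vx (w_s w t)
  - (vz (w_ss w t) - vz (w_s w t) ^ 2 / vz (w t)) * vx (w t)).
pose (q1 := fun t => vy (w_s w t) - vy (w t) * vz (w_s w t) / vz (w t)).
pose (q2 := fun t => vz (w t) * vy (w_ss w t) - vz (w_s w t) * vy (w_s w t)
  - (vz (w_ss w t) - vz (w_s w t) ^ 2 / vz (w t)) * vy (w t)).
pose (M := fun t => 3 * (kappa w t * vz (w t) ^ 2 + 2 * vz (w t) * vz (w_ss w t)
  - vz (w_s w t) ^ 2)).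
pose (r := fun t => sqrt (kappa w t)).
pose (a1 := Dsigma w (alpha_hat w)). pose (a2 := Dsigma w a1).
pose (k1 := Dsigma w (kappa_hat w)).
pose (A := fun t => alpha_hat w t * r t ^ 3).
pose (A1 := fun t => r t ^ 4 * (a1 t + 3 / 2 * kappa_hat w t * alpha_hat w t)).
pose (A2 := fun t => r t ^ 5 * (a2 t + 7 / 2 * kappa_hat w t * a1 t
  + (3 / 2 * k1 t + 3 * kappa_hat w t ^ 2) * alpha_hat w t)).
pose (m1 := fun t => 3 * vz (w t) ^ 3 * A t).
pose (m2 := fun t => 9 * vz (w t) ^ 3 * vz (w_s w t) * A t + 3 * vz (w t) ^ 4 * A1 t).
pose (m3 := fun t => 27 * vz (w t) ^ 3 * vz (w_s w t) ^ 2 * A t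
  + 9 * vz (w t) ^ 4 * vz (w_ss w t) * A t
  + 21 * vz (w t) ^ 4 * vz (w_s w t) * A1 t + 3 * vz (w t) ^ 5 * A2 t).
assert (Hc : forall u, U u -> c u <> 0) by (intros u Hu; now apply cbrt_neq_0, HD).
assert (Hr : forall u, U u -> 0 < r u) by (intros u Hu; now apply sqrt_lt_R0, Hk).
destruct (smooth_on_w_ders U w Hw) as ((S1x & S1y & S1z) & (S2x & S2y & S2z) & _).
pose proof (fun f Hf u Hu => is_derive_Ds U w f u Hw Hf Hu) as Ds_.
assert (F : forall u, U u ->
  (is_derive X u (h u * p1 u) /\ is_derive p1 u (h u * p2 u) /\
   is_derive p2 u (h u * (- (M u / 3) * p1 u))) /\
  (is_derive (fun u => vy (w u) / vz (w u)) u (h u * q1 u) /\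
   is_derive q1 u (h u * q2 u)) /\
  is_derive M u (h u * m1 u) /\ is_derive m1 u (h u * m2 u) /\
  is_derive m2 u (h u * m3 u)).
{ intros u Hu. destruct (Hproj u Hu) as [Hz _].
  destruct (w_sss_frame U w u Hw Hu) as (Ex & Ey & Ez).
  pose proof (Ds_ _ S2x u Hu) as D2x. pose proof (Ds_ _ S2y u Hu) as D2y.
  pose proof (Ds_ _ S2z u Hu) as D2z.
  change (Ds w _ u) with (vx (w_sss w u)) in D2x. rewrite Ex in D2x.
  change (Ds w _ u) with (vy (w_sss w u)) in D2y. rewrite Ey in D2y.
  change (Ds w _ u) with (vz (w_sss w u)) in D2z. rewrite Ez in D2z.
  destruct (s_derivatives_of_alpha c r (alpha_hat w) a1 (kappa_hat w) (a2 u) (k1 u) u)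
    as [DA DA1].
  { now apply (is_derive_sqrt_kappa U). }
  { apply (is_derive_Dsigma U); auto. now apply smooth_on_kappa_hat. }
  { apply (is_derive_Dsigma U); auto. now apply smooth_on_alpha_hat. }
  { apply (is_derive_Dsigma U); auto. now apply smooth_on_Dsigma, smooth_on_alpha_hat. }
  pose proof (Ds_ _ (smooth_on_kappa U w Hw) u Hu) as Dk.
  rewrite alpha_hat_sqrt in Dk by auto.
  destruct (projection_chi_derivatives c (fun t => vx (w t)) (fun t => vx (w_s w t))
    (fun t => vx (w_ss w t)) (fun t => vz (w t)) (fun t => vz (w_s w t))
    (fun t => vz (w_ss w t)) (kappa w) (tau w) u Hz (Ds_ _ Sx u Hu) (Ds_ _ S1x u Hu)
    D2x (Ds_ _ Sz u Hu) (Ds_ _ S1z u Hu) D2z) as (Fx & Fx1 & Fx2).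
  destruct (projection_chi_derivatives c (fun t => vy (w t)) (fun t => vy (w_s w t))
    (fun t => vy (w_ss w t)) (fun t => vz (w t)) (fun t => vz (w_s w t))
    (fun t => vz (w_ss w t)) (kappa w) (tau w) u Hz (Ds_ _ Sy u Hu) (Ds_ _ S1y u Hu)
    D2y (Ds_ _ Sz u Hu) (Ds_ _ S1z u Hu) D2z) as (Fy & Fy1 & _).
  pose proof (affine_curvature_chi_derivatives c (fun t => vz (w t))
    (fun t => vz (w_s w t)) (fun t => vz (w_ss w t)) (kappa w) (tau w) A A1 (A2 u) u Hz
    (Ds_ _ Sz u Hu) (Ds_ _ S1z u Hu) D2z Dk DA DA1) as FM.
  split; [|split; [now split | exact FM]].
  split; [exact Fx|]. split; [exact Fx1|].
  replace (- (M u / 3)) with (- (kappa w u * vz (w u) ^ 2 + 2 * vz (w u) * vz (w_ss w u)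
    - vz (w_s w u) ^ 2)) by (unfold M; field).
  exact Fx2. }
assert (SX : smooth_on U X).
{ apply (smooth_on_div U (fun t => vx (w t)) (fun t => vz (w t))); auto.
  intros u Hu. now apply Hproj. }
assert (Hp1 : forall u, U u -> p1 u <> 0).
{ intros u Hu E. destruct (F u Hu) as ((DX & _) & _). apply is_derive_unique in DX.
  rewrite E, Rmult_0_r in DX. now apply (Hproj u Hu). }
assert (Hpq : forall u, U u -> p1 u * q2 u - q1 u * p2 u = 1).
{ intros u Hu. rewrite <- (det3_w_ws_wss U w u Hw Hu).
  unfold p1, q1, p2, q2, det3, dot3, cross3; cbn [vx vy vz]. field. now apply Hproj. }
(* The graph relation is known only near [t], so the domain is shrunk before the abscissa is
   inverted. *)
assert (HL : exists U' : R -> Prop, open U' /\ U' t /\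
  forall u, U' u -> U u /\ Y (X u) = vy (w u) / vz (w u)).
{ destruct (filter_and _ _ (HU t Ht) HY) as [e He].
  exists (fun u => t - e < u < t + e).
  split; [apply open_and; [apply open_gt | apply open_lt]|].
  split; [pose proof (cond_pos e); lra|].
  intros u Hu. apply He. now apply Rabs_lt_between'. }
destruct HL as (U' & HU' & Ht' & HUU').
destruct (smooth_local_inverse U' X t) as (W & V & g & HW & HV & HWt & HWU & HXV & HgV & Sg).
{ exact HU'. } { exact Ht'. }
{ apply (smooth_on_subset U); [|exact SX]. intros u Hu. now apply HUU'. }
{ now apply Hproj. }
assert (HWU' : forall u, W u -> U u) by (intros u Hu; now apply HUU', HWU).
(* [Y] is constrained only by the graph relation; on [V] this forces it to be [vy / vz] composed
   with the smooth inverse [g]. *)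
assert (SY : smooth_on V Y).
{ apply (smooth_on_ext _ (fun v => vy (w (g v)) / vz (w (g v))) _ HV).
  - intros v Hv. destruct (HgV v Hv) as [Hg E]. destruct (HUU' _ (HWU _ Hg)) as [_ E'].
    now rewrite <- E', E.
  - apply (smooth_on_comp V U g (fun u => vy (w u) / vz (w u))); auto.
    + intros v Hv. now apply HWU', HgV.
    + apply (smooth_on_div U (fun t => vy (w t)) (fun t => vz (w t))); auto.
      intros u Hu. now apply Hproj. }
destruct (eta_along_curve W V Y h X p1 p2 (fun u => vy (w u) / vz (w u)) q1 q2 M m1 m2
  (m3 t) t) as (N2 & E1 & E); try assumption;
  try (intros u Hu; apply HWU' in Hu; now apply F).
{ intros v Hv. exists (g v). now apply HgV. }
{ intros u Hu. split; [now apply HXV | now apply HUU', HWU]. }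
{ intros u Hu. apply HWU' in Hu. split; [|now split; [apply Hp1 | apply Hpq]].
  apply Rmult_integral_contrapositive. split; [now apply Hc|].
  now apply Rinv_neq_0_compat, Hproj. }
{ now apply F. }
pose proof (Hr t Ht) as Hrt. destruct (Hproj t Ht) as [Hz _].
split.
- split; [|split; [exact N2|]].
  + apply (proj1 (smooth_on_iff_smooth_at V Y HV) SY). now apply HXV.
  + rewrite E1. unfold m1, A.
    repeat apply Rmult_integral_contrapositive_currified;
      try apply pow_nonzero; auto; lra.
- rewrite E. unfold m1, m2, m3, M. rewrite eta_numerator.
  change (cbrt_pow ?v 8) with (cbrt v ^ 8). rewrite !cbrt_mult.
  rewrite (cbrt_unique (vz (w t)) (vz (w t) ^ 3)) by reflexivity.
  unfold A. rewrite cbrt_mult, (cbrt_unique (r t) (r t ^ 3)) by reflexivity.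
  replace (kappa w t) with (r t ^ 2) by (apply pow2_sqrt, Rlt_le, Hk, Ht).
  unfold A1, A2. fold a1. fold a2. fold k1.
  change (cbrt_pow ?v (-2)) with (/ cbrt v ^ 2).
  change (cbrt_pow ?v (-5)) with (/ cbrt v ^ 5).
  change (cbrt_pow ?v (-8)) with (/ cbrt v ^ 8).
  pose proof (cbrt_cube (alpha_hat w t)) as Ea.
  pose proof (cbrt_neq_0 _ Hal) as Ha0.
  pose proof (cbrt_neq_0 3 ltac:(lra)) as H30.
  (* After division by 6 the numerator keeps a factor 9 against [3^(8/3)] below, which yields
     [3^(-2/3)]; writing 9 as a power of [cbrt 3] leaves a rational identity. *)
  assert (E3 : 9 = cbrt 3 ^ 6).
  { transitivity ((cbrt 3 ^ 3) ^ 2); [rewrite cbrt_cube|]; ring. }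
  revert Ea Ha0. generalize (cbrt (alpha_hat w t)) as al3. intros al3 <- Hal3.
  replace 54 with (6 * 9) by ring. replace 63 with (6 * (9 * (7 / 6))) by field.
  replace 81 with (6 * (9 * (3 / 2))) by field. rewrite E3.
  field. repeat split; auto. lra.
Qed.

(** * Curves parametrized by their first coordinate, and the form for positive [alpha_hat] *)

Lemma Rpower_third_cbrt (x : R) : 0 < x -> Rpower x (1 / 3) = cbrt x.
Proof.
intros Hx. unfold cbrt. now rewrite (sign_eq_1 x Hx), Rabs_pos_eq, Rmult_1_l by lra.
Qed.

Theorem mainTheorem11 :
  forall (a b : Rbar) (y z : R -> R),
  let w := fun x : R => Vec3 x (y x) (z x) in
  (forall x : R, Rbar_lt a x -> Rbar_lt x b ->
     smooth_at y x /\ smooth_at z x /\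
     z x <> 0 /\ z x - x * Derive z x <> 0 /\
     w_Delta w x <> 0 /\ 0 < kappa w x /\ alpha_hat w x <> 0) ->
  forall x : R, Rbar_lt a x -> Rbar_lt x b ->
  let X := fst (Pi0 (w x)) in
  let al := alpha_hat w x in
  let al_sigma := Dsigma w (alpha_hat w) x in
  let al_sigmasigma := Dsigma w (Dsigma w (alpha_hat w)) x in
  let kh_expr :=
    Dsigma w (kappa_hat w) x + 1 / 4 * (kappa_hat w x) ^ 2 - 1 in
  (exists Y : R -> R, is_projected_graph w x Y) /\
  (forall Y : R -> R, is_projected_graph w x Y ->
     eta_defined Y X /\
     eta Y X =
       cbrt_pow 3 (-2) *
       (cbrt_pow al (-5) * al_sigmasigma
        - 7 / 6 * cbrt_pow al (-8) * al_sigma ^ 2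
        + 3 / 2 * cbrt_pow al (-2) * kh_expr) /\
     (0 < al ->
      eta Y X =
        cbrt_pow 3 1 *
        (- 2 * Rpower al (-1 / 2)
           * Dsigma w (Dsigma w (fun t => Rpower (alpha_hat w t) (-1 / 6))) x
         + 1 / 2 * cbrt_pow al (-2) * kh_expr))).
Proof.
intros a b y z w H x Hax Hxb.
set (U := fun t : R => Rbar_lt a t /\ Rbar_lt t b).
assert (HU : open U) by (apply open_and; [apply open_Rbar_gt | apply open_Rbar_lt]).
assert (Ht : U x) by now split.
assert (HH : forall t, U t -> smooth_at y t /\ smooth_at z t /\
  z t <> 0 /\ z t - t * Derive z t <> 0 /\
  w_Delta w t <> 0 /\ 0 < kappa w t /\ alpha_hat w t <> 0).
{ intros t [Hat Htb]. now apply H. }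
clear H Hax Hxb.
assert (Sz : smooth_on U z) by (apply smooth_on_iff_smooth_at; [easy | now apply HH]).
assert (Sy : smooth_on U y) by (apply smooth_on_iff_smooth_at; [easy | now apply HH]).
assert (Hw : positively_curved_on U w).
{ split; [|now apply HH]. split; [exact HU|]. split; [now apply smooth_on_id|].
  split; [exact Sy|]. split; [exact Sz | now apply HH]. }
assert (Hproj : forall t, U t ->
  vz (w t) <> 0 /\ Derive (projection_abscissa w) t <> 0).
{ intros t H. destruct (HH t H) as (_ & _ & Hz & Hzz & _). split; [exact Hz|].
  replace (Derive (projection_abscissa w) t) with ((z t - t * Derive z t) / z t ^ 2).
  - apply Rmult_integral_contrapositive. split; [exact Hzz|].
    now apply Rinv_neq_0_compat, pow_nonzero.
  - symmetry. apply is_derive_unique.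
    pose proof (smooth_on_is_derive U z t Sz H).
    change (is_derive (fun t => t / z t) t ((z t - t * Derive z t) / z t ^ 2)).
    derive_from_context. field. exact Hz. }
split.
- assert (SX : smooth_on U (projection_abscissa w)).
  { apply (smooth_on_div U (fun t => t) z HU); auto using smooth_on_id.
    intros t H. now apply HH. }
  destruct (smooth_local_inverse U (projection_abscissa w) x HU Ht SX)
    as (W & V & g & HW & _ & HWx & _ & HXV & _); [now apply Hproj|].
  (* Only [g (X t) = t] near [x] matters here, with [X] the abscissa: it returns the parameter at
     which the ordinate is read. *)
  exists (fun v => snd (Pi0 (w (g v)))).
  unfold is_projected_graph. apply (filter_imp W); [|now apply HW].
  intros t Hut. change (fst (Pi0 (w t))) with (projection_abscissa w t).
  now rewrite (proj2 (HXV t Hut)).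
- intros Y HY.
  assert (Hal : alpha_hat w x <> 0) by now apply HH.
  destruct (eta_of_projection U w x Y Hw Ht Hproj Hal HY) as [E1 E2].
  split; [exact E1|]. split; [exact E2|].
  intros Hpos.
  change (fst (Pi0 (w x))) with (projection_abscissa w x). rewrite E2.
  rewrite (Dsigma2_Rpower_alpha_hat U) by easy.
  assert (Ep : Rpower (alpha_hat w x) (-1 / 2) * Rpower (alpha_hat w x) (-1 / 6)
    = / cbrt (alpha_hat w x) ^ 2).
  { rewrite <- Rpower_plus, <- Rpower_third_cbrt by easy.
    rewrite <- Rpower_pow by apply exp_pos. rewrite Rpower_mult, <- Rpower_Ropp.
    f_equal. simpl. field. }
  (* The constants combine to [1/3], and the two powers of [alpha_hat] are brought together to form
     the exponent [-2/3]. *)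
  match goal with |- _ = ?c * (- 2 * ?p * (- 1 / 6 * ?q * ?e) + ?f) =>
    replace (- 2 * p * (- 1 / 6 * q * e)) with (1 / 3 * (p * q) * e)
      by (generalize e; intros; field) end.
  rewrite Ep.
  change (cbrt_pow ?v (-2)) with (/ cbrt v ^ 2).
  change (cbrt_pow ?v (-5)) with (/ cbrt v ^ 5).
  change (cbrt_pow ?v (-8)) with (/ cbrt v ^ 8).
  change (cbrt_pow 3 1) with (cbrt 3 ^ 1).
  pose proof (cbrt_neq_0 _ Hal) as Ha0.
  pose proof (cbrt_neq_0 3 ltac:(lra)) as H30.
  (* Gives both forms the prefactor [3^(-2/3)]; the extra 3 absorbs the [1/3] above. *)
  replace (cbrt 3 ^ 1) with (3 * / cbrt 3 ^ 2)
    by (rewrite <- (cbrt_cube 3) at 1; field; exact H30).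
  assert (Ea : alpha_hat w x = cbrt (alpha_hat w x) ^ 3) by now rewrite cbrt_cube.
  (* Only these denominators are rewritten as powers of the cube root; a global rewrite would also
     act inside [cbrt (alpha_hat w x)]. *)
  match goal with |- context [?u / alpha_hat w x + ?v / alpha_hat w x ^ 2] =>
    replace (u / alpha_hat w x + v / alpha_hat w x ^ 2) with
      (u / cbrt (alpha_hat w x) ^ 3 + v / (cbrt (alpha_hat w x) ^ 3) ^ 2)
      by now rewrite <- Ea end.
  field. now split.
Qed.
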